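(* Let $\Sigma=\{0,\dots,6\}$ and let $C=\{(0,1,2),(0,2,3),(0,3,4),(0,4,5),(0,5,6),(0,6,1)\}$. Let $x_{eq}=(x_0,\dots,x_6)\in(\mathbb{R}^2)^7$ be a triangle mesh with connectivity $C$ all of whose six triangles are equilateral (so $x_1,\dots,x_6$ are, in counterclockwise order, the vertices of a regular hexagon with center $x_0$), and let $\Lambda_{eq}=\operatorname{Sim}(\mathbb{R}^2).x_{eq}\subset\mathbb{R}^{14}$ be its orbit under the group of similarities. Let $\Theta$ be the mesh transformation for the connectivity $C$. Then $\Lambda_{eq}$ is a local attractor of $\Theta$: there exists a neighborhood $U_{eq}\subset\mathbb{R}^{14}$ of $\Lambda_{eq}$ such that for every mesh $x\in U_{eq}$ with connectivity $C$, the iterates $\Theta^n(x)$ converge, as $n\to\infty$, to a single mesh belonging to $\Lambda_{eq}$.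
   Context: Here $\operatorname{Sim}(\mathbb{R}^2)$ denotes the four-dimensional group of maps $g(y)=\lambda(Ay+b)$ of $\mathbb{R}^2$ with $\lambda>0$, $A\in SO(2)$, $b\in\mathbb{R}^2$; it acts on $(\mathbb{R}^2)^N$ by $g.(x_0,\dots,x_{N-1})=(g(x_0),\dots,g(x_{N-1}))$. Triangle meshes: given a finite set of symbols $\Sigma=\{0,\dots,N-1\}$ and a finite set $C$ of triples $\Delta_i=(i_0,i_1,i_2)\in\Sigma^3$ (a connectivity: any two triples can be joined by a sequence of triples in $C$ in which consecutive ones share exactly two symbols), a triangle mesh with connectivity $C$ is an injective map $\Sigma\to\mathbb{R}^2$, $k\mapsto x_k$, identified with $x=(x_0,\dots,x_{N-1})\in(\mathbb{R}^2)^N=\mathbb{R}^{2N}$, such that the triangles $(x_{i_0},x_{i_1},x_{i_2})$, with vertices listed counterclockwise, are non-degenerate and have pairwise disjoint interiors. Triangle transformation: for a triangle $(y_0,y_1,y_2)$ with centroid $c=\frac13(y_0+y_1+y_2)$ and $r_j=\|y_{j-1}-c\|/\|y_j-c\|$ (indices modulo $3$), set $$\theta_j(y_0,y_1,y_2)=\tfrac23 r_j(y_j-c)-\tfrac13 r_{j+1}(y_{j+1}-c)-\tfrac13 r_{j-1}(y_{j-1}-c)+c,\quad j\in\mathbb{Z}_3.$$ Mesh transformation: for $k\in\Sigma$ let $\Sigma_k$ be the set of indices $m$ of triples $\Delta_m=(m_0,m_1,m_2)\in C$ containing the symbol $k$, and let $j(m)\in\{0,1,2\}$ be the position of $k$ in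 $\Delta_m$. Then $\Theta(x)=(\Theta_0(x),\dots,\Theta_{N-1}(x))$ with $$\Theta_k(x)=\frac1{|\Sigma_k|}\sum_{m\in\Sigma_k}\theta_{j(m)}(x_{m_0},x_{m_1},x_{m_2}).$$ *)

(* Defs.v *)
From mathcomp Require Import all_boot all_order all_algebra.
From mathcomp Require Import all_classical all_reals all_analysis.

Set Implicit Arguments.
Unset Strict Implicit.
Unset Printing Implicit Defensive.

Import Order.TTheory GRing.Theory Num.Theory.
Import numFieldNormedType.Exports.

Local Open Scope classical_set_scope.
Local Open Scope ring_scope.

(* A point of R^2 is a column vector, and (x_0, ..., x_(N-1)) in (R^2)^N is the
   2 x N matrix whose k-th column is x_k. *)

(* The library norm on matrices is the sup norm, hence this definition. *)
Definition enorm (R : realType) (v : 'cV[R]_2) : R :=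
  Num.sqrt (v 0 0 ^+ 2 + v 1 0 ^+ 2).

Definition SO2 (R : realType) : set 'M[R]_2 :=
  [set A | A *m A^T = 1%:M /\ \det A = 1].

Definition Sim (R : realType) : set ('cV[R]_2 -> 'cV[R]_2) :=
  [set g | exists (l : R) (A : 'M[R]_2) (b : 'cV[R]_2),
     [/\ 0 < l, SO2 A & forall y, g y = l *: (A *m y + b)]].

Definition mesh_act (R : realType) (N : nat) (g : 'cV[R]_2 -> 'cV[R]_2)
    (x : 'M[R]_(2, N)) : 'M[R]_(2, N) :=
  \matrix_(i, k) g (col k x) i 0.

Definition Sim_orbit (R : realType) (N : nat) (x : 'M[R]_(2, N)) :
    set 'M[R]_(2, N) :=
  [set mesh_act g x | g in @Sim R].

(* The arithmetic on vertex indices below is that of 'I_3 = Z/3. *)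
Definition triangle (R : realType) := 'I_3 -> 'cV[R]_2.

Definition triangle_set (R : realType) (y : triangle R) : set 'cV[R]_2 :=
  [set p | exists a : 'I_3 -> R, [/\ forall j, 0 <= a j, \sum_j a j = 1
                                   & p = \sum_j a j *: y j]].

(* Twice the signed area: nonzero iff the triangle is non-degenerate, and then
   positive iff the vertices are listed counterclockwise. *)
Definition signed_area2 (R : realType) (y : triangle R) : R :=
  let u := y 1 - y 0 in let v := y 2 - y 0 in
  u 0 0 * v 1 0 - u 1 0 * v 0 0.

Definition equilateral (R : realType) (y : triangle R) : Prop :=
  enorm (y 0 - y 1) = enorm (y 1 - y 2) /\
  enorm (y 1 - y 2) = enorm (y 2 - y 0).

Definition centroid (R : realType) (y : triangle R) : 'cV[R]_2 :=
  3^-1 *: (y 0 + y 1 + y 2).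

Definition vertex_ratio (R : realType) (y : triangle R) (j : 'I_3) : R :=
  enorm (y (j - 1) - centroid y) / enorm (y j - centroid y).

Definition theta (R : realType) (y : triangle R) (j : 'I_3) : 'cV[R]_2 :=
  let c := centroid y in
  (2 / 3 * vertex_ratio y j) *: (y j - c)
  - (1 / 3 * vertex_ratio y (j + 1)) *: (y (j + 1) - c)
  - (1 / 3 * vertex_ratio y (j - 1)) *: (y (j - 1) - c) + c.

Definition share2 (N : nat) (t u : 3.-tuple 'I_N) : bool :=
  #|[set k : 'I_N | (k \in t) && (k \in u)]%SET| == 2%N.

Definition connectivity (N : nat) (C : {set 3.-tuple 'I_N}) : Prop :=
  forall t u, t \in C -> u \in C ->
    exists s : seq (3.-tuple 'I_N),
      [/\ all (mem C) s, path (@share2 N) t s & last t s = u].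

Definition mesh_triangle (R : realType) (N : nat) (x : 'M[R]_(2, N))
    (t : 3.-tuple 'I_N) : triangle R :=
  fun j => col (tnth t j) x.

Definition is_mesh (R : realType) (N : nat) (C : {set 3.-tuple 'I_N})
    (x : 'M[R]_(2, N)) : Prop :=
  [/\ connectivity C,
      injective (fun k : 'I_N => col k x),
      forall t, t \in C -> 0 < signed_area2 (mesh_triangle x t)
    & forall t u, t \in C -> u \in C -> t != u ->
        (triangle_set (mesh_triangle x t))° `&`
        (triangle_set (mesh_triangle x u))° = set0].

Definition triples_at (N : nat) (C : {set 3.-tuple 'I_N}) (k : 'I_N) :
    {set 3.-tuple 'I_N} :=
  [set t in C | k \in t]%SET.

(* The position of k in t, meaningful when k \in t. *)
Definition position (N : nat) (k : 'I_N) (t : 3.-tuple 'I_N) : 'I_3 :=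
  inord (index k t).

Definition Theta (R : realType) (N : nat) (C : {set 3.-tuple 'I_N})
    (x : 'M[R]_(2, N)) : 'M[R]_(2, N) :=
  \matrix_(i, k) (#|triples_at C k|%:R^-1 *:
    \sum_(t in triples_at C k) theta (mesh_triangle x t) (position k t)) i 0.

(* The hexagonal connectivity; in 'I_7 the numerals below 7 denote themselves. *)
Definition hexC : {set 3.-tuple 'I_7} :=
  [set [tuple 0; 1; 2]; [tuple 0; 2; 3]; [tuple 0; 3; 4];
       [tuple 0; 4; 5]; [tuple 0; 5; 6]; [tuple 0; 6; 1]]%SET.

Lemma share2E (N : nat) (t u : 3.-tuple 'I_N) :
  share2 t u = (count [in u] (undup t) == 2%N).
Proof.
rewrite /share2; congr (_ == _); rewrite -size_filter.
rewrite -(card_uniqP (filter_uniq _ (undup_uniq t))).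
by apply: eq_card => k; rewrite !inE mem_filter mem_undup andbC.
Qed.

Lemma hexC_connectivity : connectivity hexC.
Proof.
pose L : seq (3.-tuple 'I_7) :=
  [:: [tuple 0; 1; 2]; [tuple 0; 2; 3]; [tuple 0; 3; 4];
      [tuple 0; 4; 5]; [tuple 0; 5; 6]; [tuple 0; 6; 1]].
have hexL t : (t \in hexC) = (t \in L) by rewrite !inE -!orbA.
pose share (t u : 3.-tuple 'I_7) := count [in u] (undup t) == 2%N.
pose walk t u : seq (3.-tuple 'I_7) :=
  let r := rot (index t L) L in take (index u r) (behead r).
have ok : all (fun t => all (fun u =>
    [&& all (mem L) (walk t u), path share t (walk t u)
      & last t (walk t u) == u]) L) L by vm_compute.
move=> t u; rewrite !hexL => /(allP ok) /allP/[apply] /and3P[sL sp /eqP su].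
exists (walk t u); split=> //; first by rewrite (eq_all (a2 := mem L)).
by rewrite (@eq_path _ _ share) // => v w; exact: share2E.
Qed.

(* Main.v *)
Require Import Defs.
From HB Require Import structures.
From mathcomp Require Import all_boot all_order all_algebra.
From mathcomp Require Import all_classical all_reals all_analysis.
From mathcomp Require Import complex ring lra.

(* Identify R^2 with the complex numbers, let zeta = exp (i pi / 3) and omega =
   zeta ^ 2. At an equilateral triangle the triangle transformation fixes the
   centroid and the Fourier coefficient carrying the equilateral shape, and
   multiplies the other one (the defect) by - omega / 2; its linearization does
   not depend on the triangle, and its error is quadratic in the defect. The
   mesh transformation therefore has the same complex linear part L at every
   point of the orbit. L is diagonalized by the Fourier modes of the rim of the
   hexagon (and the offset of the center from the centroid of the rim): the
   modes transverse to the orbit have eigenvalues 1 - q (1 + zeta) / 12 with q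
   in {1, 3, 4}, of modulus at most 8 / 9. Near the orbit, the sum of the moduli
   of the transverse modes thus contracts geometrically while bounding the
   displacement, so that the iterates form a Cauchy sequence; in the limit the
   transverse modes vanish, which characterizes the regular hexagons. *)

Set Implicit Arguments.
Unset Strict Implicit.
Unset Printing Implicit Defensive.

Import Order.TTheory GRing.Theory Num.Theory.
Import numFieldNormedType.Exports.
Import ComplexField.Normc.

Local Open Scope classical_set_scope.
Local Open Scope ring_scope.

(** * Contracting defects *)

(* The potential [`|x - z| + d x / (1 - q)] does not increase along an orbit,
   which therefore cannot leave the ball. *)
Lemma iter_cvg_of_contracting_defect (R : realType)
    (V : completeNormedModType R) (F : V -> V) (d : V -> R) (z : V) (r q : R) :
    0 < r -> 0 <= q < 1 -> (forall x, 0 <= d x) -> continuous d -> d z = 0 ->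
    (forall x, `|x - z| < r -> d (F x) <= q * d x) ->
    (forall x, `|x - z| < r -> `|F x - x| <= d x) ->
  \forall x \near z, exists y,
    [/\ `|y - z| < r, d y = 0 & (fun n => iter n F x) @ \oo --> y].
Proof.
move=> r0 /andP[q0 q1] d0 cd dz dF nF.
have q1' : 0 < 1 - q by rewrite subr_gt0.
(* The distance to [z] and [d x / (1 - q)] both start below [e], so the potential stays below
   [2 * e] and even the limit lies strictly inside the ball of radius [r]. *)
pose e := r / 3; have e0 : 0 < e by rewrite divr_gt0.
have := cd z; rewrite /continuous_at dz => /cvgrPdist_lt dz0.
near=> x.
have xz : `|x - z| < e.
  by rewrite distrC; near: x; exact: cvgr_dist_lt.
have dx : d x < (1 - q) * e.
  have : `|0 - d x| < (1 - q) * e by near: x; apply: dz0; rewrite mulr_gt0.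
  by rewrite sub0r normrN ger0_norm.
pose u n := iter n F x.
have inv n : `|u n - z| + d (u n) / (1 - q) < 2 * e /\ d (u n) <= d x * q ^+ n.
  elim: n => [|n [IH1 IH2]].
    rewrite expr0 mulr1 /u /=.
    rewrite mulr_natl mulr2n; split=> //; apply: ltrD => //.
    by rewrite ltr_pdivrMr // mulrC.
  have un : `|u n - z| < r.
    have : 0 <= d (u n) / (1 - q) by rewrite divr_ge0 // ltW.
    rewrite /e in IH1 *; lra.
  have dn := dF _ un; have nn := nF _ un.
  rewrite /u iterS -/(u n); split; last first.
    apply: (le_trans dn); rewrite exprS mulrCA ler_wpM2l //.
  apply: le_lt_trans IH1.
  have -> : F (u n) - z = (F (u n) - u n) + (u n - z) by rewrite addrA subrK.
  apply: (le_trans (lerD (ler_normD _ _) (lexx _))).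
  have : d (F (u n)) / (1 - q) <= q * d (u n) / (1 - q).
    by rewrite ler_pM2r // invr_gt0.
  have : d (u n) / (1 - q) = d (u n) + q * d (u n) / (1 - q).
    by field; rewrite gt_eqF.
  lra.
have ball_n n : `|u n - z| < 2 * e.
  have [] := inv n; have : 0 <= d (u n) / (1 - q) by rewrite divr_ge0 // ltW.
  lra.
have qn : `|q| < 1 by rewrite ger0_norm.
(* The increments are bounded by [d x * q ^+ n], so the telescoping series converges absolutely. *)
have cu : cvgn u.
  have -> : u = (fun n => u 0%N + series (telescope u) n).
    by apply/funext => n; exact: eq_sum_telescope.
  apply: is_cvgD; first exact: is_cvg_cst.
  apply: normed_cvg.
  apply: (@series_le_cvg _ _ (geometric (d x) q)) => [n|n|n|].
  - exact: normr_ge0.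
  - by rewrite /geometric /= mulr_ge0 // exprn_ge0.
  - rewrite /telescope /geometric /=.
    have [_] := inv n; apply: le_trans; apply: nF.
    by apply: lt_trans (ball_n n) _; rewrite /e; lra.
  - exact: is_cvg_geometric_series.
exists (limn u); split => //.
- apply: (@le_lt_trans _ _ (2 * e)); last by rewrite /e; lra.
  have cz : (fun n => `|u n - z|) @ \oo --> `|limn u - z|.
    by apply: cvg_norm; apply: cvgB => //; exact: cvg_cst.
  apply: (ler_cvg_to cz (cvg_cst (2 * e))).
  by apply: nearW => n; exact: ltW.
- have c1 : (fun n => d (u n)) @ \oo --> d (limn u).
    by apply: (cvg_comp u d) cu _; exact: cd.
  have c0 : (fun n => d (u n)) @ \oo --> (0 : R).
    apply: (@squeeze_cvgr _ _ _ _ (fun=> 0) (geometric (d x) q)).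
    + by apply: nearW => n; rewrite d0 /=; have [_] := inv n.
    + exact: cvg_cst.
    + exact: cvg_geometric.
  exact: (cvg_unique _ c1 c0).
Unshelve. all: by end_near. Qed.

(** Joins completeness and the norm on matrices, so that the lemma above applies to the space of
    meshes. *)
HB.instance Definition _ (R : realType) (m n : nat) :=
  Complete.on 'M[R]_(m, n).

(** * Moduli of complex numbers *)

Section ComplexBounds.
Variable R : realType.
Local Notation N := (@normc R).
Implicit Types (u v : R[i]) (t : R).

Lemma normc_def_sqr u : N u ^+ 2 = complex.Re u ^+ 2 + complex.Im u ^+ 2.
Proof. by case: u => a b; rewrite /= sqr_sqrtr // addr_ge0 ?sqr_ge0. Qed.

Lemma normc_ge0 u : 0 <= N u.
Proof. by case: u => a b; rewrite /= sqrtr_ge0. Qed.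

Lemma normr_Re_le u : `|complex.Re u| <= N u.
Proof.
rewrite -(ler_pXn2r (n := 2)) ?nnegrE ?normc_ge0 // normc_def_sqr.
by rewrite real_normK ?num_real // lerDl sqr_ge0.
Qed.

Lemma normr_Im_le u : `|complex.Im u| <= N u.
Proof.
rewrite -(ler_pXn2r (n := 2)) ?nnegrE ?normc_ge0 // normc_def_sqr.
by rewrite real_normK ?num_real // lerDr sqr_ge0.
Qed.

Lemma normc_le_ReIm u : N u <= `|complex.Re u| + `|complex.Im u|.
Proof.
rewrite -(ler_pXn2r (n := 2)) ?nnegrE ?normc_ge0 ?addr_ge0 // normc_def_sqr.
by rewrite sqrrD !real_normK ?num_real // addrAC lerDl mulrn_wge0 //.
Qed.

Lemma normc_triangle u v : N (u + v) <= N u + N v.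
Proof. exact: le_normcD. Qed.

Lemma normc_opp u : N (- u) = N u.
Proof. exact: normcN. Qed.

Lemma normcB_ge u v : N u - N v <= N (u + v).
Proof.
rewrite lerBlDr -[in X in X <= _](addrK v u) -[N v]normc_opp; exact: normc_triangle.
Qed.

Lemma normc_real (a : R) : 0 <= a -> N (a%:C)%C = a.
Proof. by move=> a0; rewrite /= expr0n /= addr0 sqrtr_sqr ger0_norm. Qed.

Lemma normc_nat n : N n%:R = n%:R.
Proof.
have -> : n%:R = (n%:R : R)%:C%C by rewrite rmorph_nat.
by rewrite normc_real.
Qed.

(* With u = a + ib, the remainder e := N (1 + u) - (1 + a) satisfies
   e (N (1 + u) + 1 + a) = b^2. *)
Lemma normc_1D u t : N u <= t -> t <= 1 / 2 ->
  [/\ 0 <= N (1 + u) - (1 + complex.Re u),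
      N (1 + u) - (1 + complex.Re u) <= t ^+ 2 & 1 / 2 <= N (1 + u)].
Proof.
move=> ut t2.
have := normr_Re_le u; have := normr_Im_le u.
have := normc_def_sqr (1 + u); have := normc_ge0 (1 + u).
have : 1 - N u <= N (1 + u) by rewrite -[X in X - _]normc1; exact: normcB_ge.
have := normc_ge0 u; move: ut.
case: u => a b; rewrite [complex.Re (1 + _)]/= [complex.Im (1 + _)]/=.
rewrite [complex.Re _]/= [complex.Im _]/= add0r.
move: (N (1 + _)) (N _) => n m mt m0 nm n0 n2.
rewrite !ler_norml => /andP[b1 b2] /andP[a1 a2].
have h1 : 1 / 2 <= n by lra.
have h2 : 1 / 2 <= 1 + a by lra.
have bt : b ^+ 2 <= t ^+ 2.
  have : 0 <= (t - b) * (t + b) by apply: mulr_ge0; lra.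
  by rewrite mulrDr mulrBl -!expr2; lra.
have e : (n - (1 + a)) * (n + (1 + a)) = b ^+ 2.
  by have -> : b ^+ 2 = n ^+ 2 - (1 + a) ^+ 2; [lra|ring].
have e0 : 0 <= n - (1 + a).
  rewrite -(@pmulr_lge0 _ (n + (1 + a))) ?e ?sqr_ge0 //; lra.
split=> //; apply: le_trans bt; rewrite -e ler_peMr //; lra.
Qed.

(** To first order [N (1 + v) / N (1 + u)] is [1 + Re v - Re u]: the rescaling replaces the real
    part of [u] by that of [v] and keeps the imaginary part. *)
Lemma normalize_1D_bound u v t : N u <= t -> N v <= t -> t <= 1 / 2 ->
  N ((N (1 + v) / N (1 + u))%:C%C * (1 + u)
     - Complex (1 + complex.Re v) (complex.Im u)) <= 8 * t ^+ 2.
Proof.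
move=> ut vt t2.
have [e0 e1 n2] := normc_1D ut t2; have [f0 f1 m2] := normc_1D vt t2.
apply: le_trans (normc_le_ReIm _) _.
have -> : complex.Re ((N (1 + v) / N (1 + u))%:C%C * (1 + u)
     - Complex (1 + complex.Re v) (complex.Im u)) =
   N (1 + v) / N (1 + u) * (1 + complex.Re u) - (1 + complex.Re v).
  by case: (u) => a b /=; rewrite mul0r subr0.
have -> : complex.Im ((N (1 + v) / N (1 + u))%:C%C * (1 + u)
     - Complex (1 + complex.Re v) (complex.Im u)) =
   N (1 + v) / N (1 + u) * complex.Im u - complex.Im u.
  by case: (u) => a b /=; rewrite mul0r addr0 add0r.
have := le_trans (normr_Re_le u) ut; have := le_trans (normr_Im_le u) ut.
have := le_trans (normr_Re_le v) vt.
move: e0 e1 n2 f0 f1 m2.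
move: (complex.Re u) (complex.Im u) (complex.Re v) (N (1 + u)) (N (1 + v)).
move=> a b c n m e0 e1 n2 f0 f1 m2.
have t0 : 0 <= t by exact: le_trans (normc_ge0 u) ut.
rewrite !ler_norml => /andP[c1 c2] /andP[b1 b2] /andP[a1 a2].
have n0 : 0 < n by lra.
have nn : n != 0 by rewrite gt_eqF.
have n1 : n^-1 <= 2 by rewrite invf_ple ?posrE //; lra.
have ni : 0 <= n^-1 by rewrite invr_ge0 ltW.
have t22 : t ^+ 2 <= 1 / 2 * t by rewrite expr2 ler_wpM2r.
(* As [n^-1 <= 2], the real and imaginary parts contribute [3 * t ^+ 2] and [5 * t ^+ 2] to the
   total. *)
have -> : m / n * (1 + a) - (1 + c) =
  n^-1 * ((m - (1 + c)) * (1 + a) - (1 + c) * (n - (1 + a))) by field.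
have -> : m / n * b - b = n^-1 * (b * (m - n)) by field.
have p1 : `|(m - (1 + c)) * (1 + a) - (1 + c) * (n - (1 + a))| <= 3 / 2 * t ^+ 2.
  have A : 0 <= (m - (1 + c)) * (1 + a) <= 3 / 2 * t ^+ 2.
    by rewrite mulr_ge0 //= ?[3 / 2 * _]mulrC ?ler_pM //; lra.
  have B : 0 <= (1 + c) * (n - (1 + a)) <= 3 / 2 * t ^+ 2.
    by rewrite mulr_ge0 //= ?ler_pM //; lra.
  by rewrite ler_norml; lra.
have p2 : `|b * (m - n)| <= t * (5 / 2 * t).
  by rewrite normrM ler_pM //; rewrite ler_norml; lra.
have q1 := ler_pM ni (normr_ge0 _) n1 p1.
have q2 := ler_pM ni (normr_ge0 _) n1 p2.
rewrite !normrM (ger0_norm ni) in q1 q2 *.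
rewrite (_ : t * (5 / 2 * t) = 5 / 2 * t ^+ 2) in q2; last by ring.
lra.
Qed.

End ComplexBounds.

(** * The triangle transformation near an equilateral triangle *)

Definition zeta (R : realType) : R[i] := Complex (1 / 2) (Num.sqrt 3 / 2).

(** This is [theta] in complex coordinates at the vertex [A]; [B] is the next vertex and [D] the
    previous one. *)
Definition vertex_map (R : realType) (A B D : R[i]) : R[i] :=
  let c := 3^-1 * (A + B + D) in
  (2 / 3 * (normc (D - c) / normc (A - c)))%:C%C * (A - c)
  - (1 / 3 * (normc (A - c) / normc (B - c)))%:C%C * (B - c)
  - (1 / 3 * (normc (B - c) / normc (D - c)))%:C%C * (D - c) + c.

(* The Fourier coefficients of a triangle at the two nontrivial characters of
   Z/3, with omega = zeta - 1 and omega ^ 2 = - zeta. *)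
Definition defect (R : realType) (A B D : R[i]) : R[i] :=
  3^-1 * (A + (zeta R - 1) * B - zeta R * D).

Definition spread (R : realType) (A B D : R[i]) : R[i] :=
  3^-1 * (A - zeta R * B + (zeta R - 1) * D).

(** In [A = c + spread + defect], the defect gets the factor [(1 - zeta) / 2], that is
    [- omega / 2]. *)
Definition linear_vertex_map (R : realType) (A B D : R[i]) : R[i] :=
  A - (1 + zeta R) / 2 * defect A B D.

Section VertexMap.
Variable R : realType.
Local Notation N := (@normc R).
Local Notation z := (zeta R).
Implicit Types (A B D a u c : R[i]).

(** The minimal polynomial of zeta, modulo which [ring] and [field] reduce many identities below. *)
Lemma zeta_sq : z ^+ 2 = z - 1.
Proof.
have s3 : Num.sqrt 3 * Num.sqrt 3 = 3 :> R by rewrite -expr2 sqr_sqrtr.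
apply/eqP; rewrite eq_complex /=; apply/andP; split; apply/eqP.
  by field: s3.
by field.
Qed.

Lemma normc_zeta : N z = 1.
Proof.
have s3 : Num.sqrt 3 ^+ 2 = 3 :> R by rewrite sqr_sqrtr.
by rewrite /= !exprMn s3 (_ : _ + _ = 1) ?sqrtr1 //; field.
Qed.

Lemma conj_zetaB1 : ((z - 1)^*)%C = - z.
Proof.
by apply/eqP; rewrite eq_complex /=; apply/andP; split; apply/eqP; field.
Qed.

Lemma conj_zetaN : ((- z)^*)%C = z - 1.
Proof.
by apply/eqP; rewrite eq_complex /=; apply/andP; split; apply/eqP; field.
Qed.

Lemma zetaB1 : z - 1 = z ^+ 2. Proof. by rewrite zeta_sq. Qed.

Lemma normc_zetaX n : N (z ^+ n) = 1.
Proof.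
elim: n => [|n IH]; first by rewrite expr0 normc1.
by rewrite exprS normcM normc_zeta IH mulr1.
Qed.

(** Trades real and imaginary parts for conjugates. Conjugation being multiplicative, the
    first-order terms become polynomials in [u], its conjugate and [zeta]. *)
Lemma Complex_ReIm (u v : R[i]) : Complex (1 + complex.Re v) (complex.Im u) =
  1 + (v + v^*%C) / 2 + (u - u^*%C) / 2.
Proof.
rewrite -ReJ_add subcJ.
rewrite (_ : _ / 2 = (complex.Im u)%:C%C * 'i%C); last by field.
by apply/eqP; rewrite eq_complex; case: u v => a b [e f] /=; apply/andP; split;
  apply/eqP; ring.
Qed.

(** Relative to [c], the vertices are [a], [omega a], [omega^2 a] times [1 + u], [1 + omega u],
    [1 + omega^2 u]. The ratios depend only on the latter factors, to which [normalize_1D_bound]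
    applies pairwise. *)
Lemma vertex_map_model c a u : a != 0 -> N u <= 1 / 2 ->
  let A := c + a * (1 + u) in
  let B := c + (z - 1) * a * (1 + (z - 1) * u) in
  let D := c - z * a * (1 - z * u) in
  N (vertex_map A B D - (A - (1 + z) / 2 * (a * u))) <= 11 * (N a * N u ^+ 2).
Proof.
move=> a0 u2; cbv zeta.
set A := c + a * _; set B := c + (z - 1) * _ * _; set D := c - _ * _.
have na0 : N a != 0 by apply: contra_neq a0; exact: eq0_normc.
have cE : 3^-1 * (A + B + D) = c.
  by rewrite /A /B /D; field: zeta_sq.
have dA : A - c = a * (1 + u) by rewrite /A addrC addKr.
have dB : B - c = (z - 1) * a * (1 + (z - 1) * u) by rewrite /B addrC addKr.
have dD : D - c = - (z * a * (1 - z * u)) by rewrite /D addrC addKr.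
pose v := (z - 1) * u; pose w := - (z * u).
have nw : N (z - 1) = 1 by rewrite zetaB1 normc_zetaX.
have nv : N v <= N u by rewrite normcM nw mul1r.
have nnw : N w <= N u by rewrite normc_opp normcM normc_zeta mul1r.
have cancel x y : N a * x / (N a * y) = x / y.
  by rewrite invfM mulrACA divff // mul1r.
rewrite /vertex_map cE dA dB dD !normc_opp !normcM normc_zeta nw !mul1r.
rewrite !cancel -/v -/w.
have := normalize_1D_bound (lexx (N u)) nnw u2.
have := normalize_1D_bound nv (lexx (N u)) u2.
have := normalize_1D_bound nnw nv u2.
rewrite !Complex_ReIm.
move: (_ / N (1 + u)) (_ / N (1 + v)) (_ / N (1 + w)) => rA rB rD.
set eD := (X in N X <= _ -> _); set eB := (X in _ -> N X <= _ -> _).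
set eA := (X in _ -> _ -> N X <= _ -> _) => hD hB hA.
have conjM (p q : R[i]) : ((p * q)^*)%C = (p^*)%C * (q^*)%C by exact: rmorphM.
have cv : (v^*)%C = - z * (u^*)%C by rewrite /v conjM conj_zetaB1.
have cw : (w^*)%C = (z - 1) * (u^*)%C by rewrite /w -mulNr conjM conj_zetaN.
(* The first-order terms in the conjugate of [u] cancel among themselves, the others against the
   linear model. The weights of the errors sum to 4/3, and [8 * 4 / 3 <= 11]. *)
rewrite (_ : _ - _ = 2 / 3 * a * eA - 1 / 3 * ((z - 1) * a * eB)
    + 1 / 3 * (z * a * eD)); last first.
  rewrite /eA /eB /eD cv cw /v /w /A !rmorphM !fmorphV !rmorph_nat ?rmorph1.
  by field: zeta_sq.
apply: le_trans (normc_triangle _ _) _.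
apply: le_trans (lerD (normc_triangle _ _) (lexx _)) _.
rewrite normc_opp !normcM nw normc_zeta !mul1r !normcV !normc_nat normc1.
have na := normc_ge0 a.
have := ler_wpM2l na hA; have := ler_wpM2l na hB; have := ler_wpM2l na hD.
rewrite !(mulrCA (N a) 8).
have := mulr_ge0 na (sqr_ge0 (N u)).
lra.
Qed.

(** Fourier inversion on Z/3. *)
Lemma spreadD_defect A B D :
  let c := 3^-1 * (A + B + D) in
  let a := spread A B D in let b := defect A B D in
  [/\ A = c + (a + b), B = c + ((z - 1) * a - z * b)
    & D = c + ((z - 1) * b - z * a)].
Proof. by split; rewrite /spread /defect; field: zeta_sq. Qed.

(** In the model above, [u] is the ratio of the defect to the spread. *)
Lemma vertex_map_bound A B D : 0 < N (spread A B D) ->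
    N (defect A B D) <= N (spread A B D) / 2 ->
  N (vertex_map A B D - linear_vertex_map A B D)
    <= 11 * (N (defect A B D) ^+ 2 / N (spread A B D)).
Proof.
rewrite /linear_vertex_map.
have [] := spreadD_defect A B D.
move: (spread A B D) (defect A B D) (3^-1 * _) => a b c eA eB eD a0 ba.
have na0 : N a != 0 by rewrite gt_eqF.
have a1 : a != 0 by apply: contra_neq na0 => ->; rewrite normc0.
pose u := b / a.
have au : a * u = b by rewrite /u mulrC divfK.
have nu : N u = N b / N a by rewrite normcM normcV.
have u2 : N u <= 1 / 2 by rewrite nu ler_pdivrMr // mulrC mul1r.
have := vertex_map_model c a1 u2.
rewrite /=.
rewrite (_ : c + a * (1 + u) = A); last by rewrite eA -au; ring.
rewrite (_ : c + (z - 1) * a * _ = B); last first.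
  by rewrite eB -au; ring: zeta_sq.
rewrite (_ : c - z * a * _ = D); last first.
  by rewrite eD -au; ring: zeta_sq.
rewrite au nu => /le_trans; apply.
rewrite (_ : N a * (N b / N a) ^+ 2 = N b ^+ 2 / N a) //.
by field.
Qed.

End VertexMap.

(** * Fourier modes of the hexagon *)

Definition rim_next (k : nat) : nat := if k is 6 then 1 else k.+1.
Definition rim_prev (k : nat) : nat := if k is 1 then 6 else k.-1.

(** The mesh transformation with an arbitrary vertex rule [f] (own, next, previous vertex), so that
    [vertex_map], its linearization and the identity can be compared. *)
Definition hex_average (K : fieldType) (f : K -> K -> K -> K) (w : nat -> K)
    (k : nat) : K :=
  if k is 0 then 6^-1 * \sum_(1 <= s < 7) f (w 0%N) (w s) (w (rim_next s))
  else 2^-1 * (f (w k) (w (rim_next k)) (w 0%N)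
               + f (w k) (w 0%N) (w (rim_prev k))).

(* The mode [i = 5], which carries the regular hexagons, is left out of
   [transverse_norm]; the mode [i = 0] is the offset of the center from the
   centroid of the rim, up to the factor 6. *)
Definition transverse_mode (R : realType) (i : nat) (w : nat -> R[i]) : R[i] :=
  \sum_(0 <= s < 6) zeta R ^+ (i * s) * w s.+1
  - (if i is 0 then 6 * w 0%N else 0).

Definition transverse_norm (R : realType) (w : nat -> R[i]) : R :=
  \sum_(0 <= i < 5) normc (transverse_mode i w).

Section Hexagon.
Variable R : realType.
Local Notation N := (@normc R).
Local Notation z := (zeta R).
Implicit Types (w : nat -> R[i]) (h : R).

(** By rotational symmetry the rim modes decouple, with [q = 2 + zeta^(2 - i) - zeta^(i + 1)] for
    [i] from 1 to 4; this expression vanishes at the omitted mode 5. At [i = 0] the motion of the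
    rim contributes 1 and that of the center 2. *)
Definition hex_eigenvalue (i : nat) : R[i] :=
  1 - (nth 0 [:: 3; 3; 4; 3; 1]%N i)%:R * ((1 + z) / 12).

Lemma transverse_mode_eigen i w : (i < 5)%N ->
  transverse_mode i (hex_average (@linear_vertex_map R) w) =
  hex_eigenvalue i * transverse_mode i w.
Proof.
rewrite /transverse_mode /hex_eigenvalue /hex_average /linear_vertex_map /defect.
by case: i => [|[|[|[|[|]]]]] // _; rewrite unlock /=; field: (zeta_sq R).
Qed.

Lemma normc_hex_eigenvalue i : (i < 5)%N -> N (hex_eigenvalue i) <= 8 / 9.
Proof.
have s3 : (Num.sqrt 3 / 2) ^+ 2 = 3 / 4 :> R.
  by rewrite exprMn sqr_sqrtr //; field.
rewrite /hex_eigenvalue => i5.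
have : (0 < nth 0 [:: 3; 3; 4; 3; 1]%N i < 5)%N by move: i i5 => [|[|[|[|[|]]]]].
move: (nth _ _ _) => q hq; rewrite -(ler_pXn2r (n := 2)) ?nnegrE ?normc_ge0 ?divr_ge0 //.
have -> : 1 - q%:R * ((1 + z) / 12) =
    Complex (1 - q%:R / 8) (- (q%:R / 12 * (Num.sqrt 3 / 2))).
  have -> : z = Complex (1 / 2) 0 + Complex 0 (Num.sqrt 3 / 2).
    by apply/eqP; rewrite eq_complex /= addr0 add0r !eqxx.
  have -> : 12^-1 = (12^-1)%:C%C :> R[i] by rewrite fmorphV rmorph_nat.
  have -> : q%:R = (q%:R)%:C%C :> R[i] by rewrite rmorph_nat.
  by apply/eqP; rewrite eq_complex /=; apply/andP; split; apply/eqP; field.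
rewrite normc_def_sqr /= sqrrN exprMn s3.
have /andP[q1 q2] : 1 <= (q%:R : R) <= 4 by rewrite ler1n ler_nat.
(* The squared modulus [1 - q / 4 + q ^+ 2 / 48] is convex in [q]; on [1, 4] its maximum is 37/48,
   at 1, and this is below 64/81. *)
have : 0 <= (q%:R - 1) * (4 - q%:R : R) by apply: mulr_ge0; lra.
rewrite !expr2; lra.
Qed.

(** Fourier inversion on the rim; mode 5 drops out because regular hexagons have no defect. The
    exponents [6 - i] stand for [- i], as [zeta ^ 6 = 1]. *)
Lemma transverse_mode_defect s w : (0 < s < 7)%N ->
  18 * defect (w 0%N) (w s) (w (rim_next s)) =
  \sum_(0 <= i < 5) (if i is 0 then -1 else
       (z - 1) * z ^+ ((6 - i) * s.-1) - z ^+ ((6 - i) * s + 1))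
     * transverse_mode i w.
Proof.
rewrite /transverse_mode /defect.
by case: s => [|[|[|[|[|[|[|]]]]]]] // _; rewrite unlock /=; field: (zeta_sq R).
Qed.

(** The coefficients of the expansion above have modulus at most 2. *)
Lemma defect_le_transverse_norm s w : (0 < s < 7)%N ->
  N (defect (w 0%N) (w s) (w (rim_next s))) <= transverse_norm w / 9.
Proof.
move=> hs; rewrite ler_pdivlMr // mulrC.
rewrite -(ler_pM2l (x := 2)) // mulrA (_ : 2 * 9 = 18); last by ring.
rewrite -{1}(@normc_nat R 18) -normcM transverse_mode_defect //.
rewrite /transverse_norm mulr_sumr.
elim/big_ind2: _ => [|x1 x2 y1 y2 h1 h2|i _].
- by rewrite normc0.
- exact: (le_trans (normc_triangle _ _) (lerD h1 h2)).
rewrite normcM ler_wpM2r ?normc_ge0 //.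
case: i => [|i]; first by rewrite normc_opp normc1 ler1n.
apply: le_trans (normc_triangle _ _) _.
by rewrite normc_opp normcM zetaB1 !normc_zetaX mul1r.
Qed.

Lemma transverse_modeB i w w' :
  transverse_mode i (fun k => w k - w' k) =
  transverse_mode i w - transverse_mode i w'.
Proof.
rewrite /transverse_mode opprB addrACA addrC addrA; case: i => [|i];
  rewrite unlock /=; ring.
Qed.

Lemma normc_transverse_mode i w e : (forall k, (k < 7)%N -> N (w k) <= e) ->
  N (transverse_mode i w) <= (if i is 0 then 12 else 6) * e.
Proof.
move=> we; apply: le_trans (normc_triangle _ _) _; rewrite normc_opp.
have : N (\sum_(0 <= s < 6) z ^+ (i * s) * w s.+1) <= \sum_(0 <= s < 6) e.
  rewrite big_nat [leRHS]big_nat.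
  elim/big_ind2: _ => [|x1 x2 y1 y2 h1 h2|s /andP[_ s6]].
  - by rewrite normc0.
  - exact: (le_trans (normc_triangle _ _) (lerD h1 h2)).
  by rewrite normcM normc_zetaX mul1r we.
rewrite sumr_const_nat subn0 -[e *+ _]mulr_natl.
case: i => [|i] h; last by rewrite normc0 addr0; exact: h.
move: h; have := we 0%N isT; rewrite normcM normc_nat; lra.
Qed.

(** The constant is 12 for mode 0, which also sees the center, plus 6 for each of the four
    others. *)
Lemma transverse_norm_le w e : (forall k, (k < 7)%N -> N (w k) <= e) ->
  transverse_norm w <= 36 * e.
Proof.
move=> we; have h i := @normc_transverse_mode i w e we.
rewrite /transverse_norm unlock /=.
have := h 0%N; have := h 1%N; have := h 2%N; have := h 3%N; have := h 4%N.
rewrite /=; lra.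
Qed.

Lemma transverse_normD w w' :
  transverse_norm w <= transverse_norm w' + transverse_norm (fun k => w k - w' k).
Proof.
rewrite /transverse_norm -big_split /=; apply: ler_sum => i _.
rewrite transverse_modeB.
by rewrite -{1}(subrK (transverse_mode i w') (transverse_mode i w)) addrC normc_triangle.
Qed.

Lemma transverse_norm_ge0 w : 0 <= transverse_norm w.
Proof. by apply: sumr_ge0 => i _; exact: normc_ge0. Qed.

End Hexagon.

(** * One step of the averaged map near a regular hexagon *)

Section HexagonStep.
Variable R : realType.
Local Notation N := (@normc R).
Local Notation z := (zeta R).
Implicit Types (w : nat -> R[i]) (f g : R[i] -> R[i] -> R[i] -> R[i]) (h e : R).

Lemma hex_average_dist f g w e :
  (forall s, (0 < s < 7)%N ->
     let A := w 0%N in let B := w s in let D := w (rim_next s) in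
     [/\ N (f A B D - g A B D) <= e, N (f B D A - g B D A) <= e
       & N (f D A B - g D A B) <= e]) ->
  forall k, (k < 7)%N -> N (hex_average f w k - hex_average g w k) <= e.
Proof.
move=> H [|k] k7; rewrite /hex_average.
  rewrite -mulrBr -sumrB normcM normcV normc_nat ler_pdivrMl //.
  have -> : 6 * e = \sum_(1 <= s < 7) e by rewrite sumr_const_nat mulr_natl.
  rewrite big_nat [leRHS]big_nat.
  elim/big_ind2: _ => [|x1 x2 y1 y2 h1 h2|s s7].
  - by rewrite normc0.
  - exact: (le_trans (normc_triangle _ _) (lerD h1 h2)).
  by have [] := H s s7.
rewrite -mulrBr opprD addrACA normcM normcV normc_nat ler_pdivrMl //.
have [_ h1 _] := H k.+1 k7.
(* The second triangle at a rim vertex is the one indexed by its predecessor. *)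
have p7 : (0 < rim_prev k.+1 < 7)%N by move: k k7 {h1} => [|[|[|[|[|[|]]]]]].
have [_ _ h2] := H _ p7.
have np : rim_next (rim_prev k.+1) = k.+1.
  by move: k k7 {h1 p7 h2} => [|[|[|[|[|[|]]]]]].
rewrite np in h2.
apply: le_trans (normc_triangle _ _) _; lra.
Qed.

(** Writes the identity as an average, so that [hex_average_dist] also bounds displacements. *)
Lemma hex_average_fst w k : (k < 7)%N -> hex_average (fun A _ _ => A) w k = w k.
Proof.
by case: k => [|k] _; rewrite /hex_average ?unlock /=; field.
Qed.

Lemma defect_rot (A B D : R[i]) : defect B D A = - z * defect A B D.
Proof. by rewrite /defect; ring: (zeta_sq R). Qed.

Lemma spread_rot (A B D : R[i]) : spread B D A = (z - 1) * spread A B D.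
Proof. by rewrite /spread; ring: (zeta_sq R). Qed.

Lemma normc_defect_rot (A B D : R[i]) : N (defect B D A) = N (defect A B D).
Proof. by rewrite defect_rot normcM normc_opp normc_zeta mul1r. Qed.

Lemma normc_spread_rot (A B D : R[i]) : N (spread B D A) = N (spread A B D).
Proof. by rewrite spread_rot normcM zetaB1 normc_zetaX mul1r. Qed.

Lemma vertex_map_dist h e (A B D : R[i]) : 0 < h -> h <= N (spread A B D) ->
    N (defect A B D) <= e -> e <= h / 2 ->
  N (vertex_map A B D - linear_vertex_map A B D) <= 11 * (e ^+ 2 / h).
Proof.
move=> h0 hs de eh.
have s0 : 0 < N (spread A B D) by exact: lt_le_trans hs.
apply: le_trans (vertex_map_bound s0 _) _; first by lra.
rewrite ler_pM2l // ler_pM ?invr_ge0 ?sqr_ge0 ?normc_ge0 //.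
  by rewrite ler_pXn2r ?nnegrE ?normc_ge0 //; exact: (le_trans (normc_ge0 _) de).
by rewrite lef_pV2.
Qed.

Lemma linear_vertex_map_dist e (A B D : R[i]) : N (defect A B D) <= e ->
  N (linear_vertex_map A B D - A) <= e.
Proof.
move=> de; rewrite /linear_vertex_map addrC addKr normc_opp normcM normcM normcV.
have := normc_triangle 1 z; rewrite normc1 normc_zeta normc_nat => h.
rewrite -[e]mul1r ler_pM ?mulr_ge0 ?invr_ge0 ?normc_ge0 //; lra.
Qed.

(** The linear part contracts by 8/9 and moves points by at most [t / 9]; the smallness of [t]
    relative to [h] absorbs the quadratic error. *)
Lemma hex_average_step h w : 0 < h ->
    (forall s, (0 < s < 7)%N -> h <= N (spread (w 0%N) (w s) (w (rim_next s)))) ->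
    transverse_norm w <= h / 108 ->
  transverse_norm (hex_average (@vertex_map R) w) <= 17 / 18 * transverse_norm w /\
  forall k, (k < 7)%N ->
    N (hex_average (@vertex_map R) w k - w k) <= transverse_norm w.
Proof.
move=> h0 hs th; set t := transverse_norm w in th *.
have t0 : 0 <= t by exact: transverse_norm_ge0.
have dt s (s7 : (0 < s < 7)%N) := defect_le_transverse_norm w s7.
have t9 : t / 9 <= h / 2 by lra.
have err k : (k < 7)%N -> N (hex_average (@vertex_map R) w k
    - hex_average (@linear_vertex_map R) w k) <= 11 * ((t / 9) ^+ 2 / h).
  apply: hex_average_dist => s s7 /=; have d := dt s s7; have p := hs s s7.
  split; first exact: (vertex_map_dist h0 p d t9).
  - apply: (vertex_map_dist h0 _ _ t9); first by rewrite normc_spread_rot.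
    by rewrite normc_defect_rot.
  - apply: (vertex_map_dist h0 _ _ t9); first by rewrite 2!normc_spread_rot.
    by rewrite 2!normc_defect_rot.
have disp k : (k < 7)%N -> N (hex_average (@linear_vertex_map R) w k - w k) <= t / 9.
  move=> k7; rewrite -[w k](hex_average_fst w k7).
  apply: hex_average_dist k7 => s s7 /=; have d := dt s s7.
  split; apply: linear_vertex_map_dist; first exact: d.
    by rewrite normc_defect_rot.
  by rewrite 2!normc_defect_rot.
(* Times 11 for the vertex error and 36 for the transverse norm, this is below [t / 18], and 8/9 +
   1/18 = 17/18. *)
have eq : (t / 9) ^+ 2 / h <= t / 81 / 108.
  rewrite ler_pdivrMr //.
  have : t * t <= t * (h / 108) by rewrite ler_wpM2l.
  rewrite expr2; lra.
split.
- apply: le_trans (transverse_normD _ (hex_average (@linear_vertex_map R) w)) _.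
  have A : transverse_norm (hex_average (@linear_vertex_map R) w) <= 8 / 9 * t.
    rewrite /t /transverse_norm mulr_sumr big_nat [leRHS]big_nat.
    apply: ler_sum => i /andP[_ i5].
    rewrite transverse_mode_eigen // normcM ler_wpM2r ?normc_ge0 //.
    exact: normc_hex_eigenvalue.
  have := transverse_norm_le err; lra.
- move=> k k7; rewrite -(subrKA (hex_average (@linear_vertex_map R) w k)).
  apply: le_trans (normc_triangle _ _) _.
  have := err k k7; have := disp k k7; lra.
Qed.

(** All six defects vanish, so each rim vertex, seen from the center, is the previous one multiplied
    by [zeta]. *)
Lemma transverse_norm_eq0 w : transverse_norm w = 0 ->
  exists a, forall s, (s < 6)%N -> w s.+1 = w 0%N + a * z ^+ s.
Proof.
move=> /eqP; rewrite psumr_eq0 => [/allP h|i _]; last exact: normc_ge0.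
have d s : (0 < s < 7)%N -> defect (w 0%N) (w s) (w (rim_next s)) = 0.
  move=> s7; apply: eq0_normc; apply/eqP; rewrite eq_le normc_ge0 andbT.
  apply: le_trans (defect_le_transverse_norm w s7) _.
  rewrite /transverse_norm big1_seq ?mul0r // => i /andP[_ hi].
  by apply/eqP; exact: h.
exists (w 1%N - w 0%N).
elim=> [|s IH] s6; first by rewrite expr0 mulr1 addrC subrK.
have s7 : (0 < s.+1 < 7)%N by rewrite /= ltnW.
have := d _ s7; rewrite (_ : rim_next _ = s.+2); last first.
  by move: s s6 {IH s7} => [|[|[|[|[|]]]]].
(* Since [z * (1 - z) = 1], this multiple of the defect isolates [w s.+2]. *)
rewrite /defect => /(congr1 (fun x => (1 - z) * (3 * x))).
rewrite mulr0 mulr0 => E.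
have -> : w s.+2 = w 0%N + z * (w s.+1 - w 0%N)
   - (1 - z) * (3 * (3^-1 * (w 0%N + (z - 1) * w s.+1 - z * w s.+2))).
  by field: (zeta_sq R).
by rewrite E subr0 IH ?(ltnW s6) // addrAC subrr add0r exprS mulrCA.
Qed.

End HexagonStep.

(** * The mesh transformation in complex coordinates *)

Definition cplx (R : realType) (v : 'cV[R]_2) : R[i] := Complex (v 0 0) (v 1 0).

Definition mesh_point (R : realType) (x : 'M[R]_(2, 7)) (k : nat) : R[i] :=
  cplx (col (inord k) x).

Section MeshTransformation.
Variable R : realType.
Implicit Types (u v : 'cV[R]_2) (x : 'M[R]_(2, 7)).

Lemma cplxD u v : cplx (u + v) = cplx u + cplx v.
Proof. by rewrite /cplx !mxE. Qed.

Lemma cplxN u : cplx (- u) = - cplx u.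
Proof. by rewrite /cplx !mxE. Qed.

Lemma cplxB u v : cplx (u - v) = cplx u - cplx v.
Proof. by rewrite cplxD cplxN. Qed.

Lemma cplxZ (a : R) u : cplx (a *: u) = a%:C%C * cplx u.
Proof.
rewrite /cplx !mxE; apply/eqP.
by rewrite eq_complex /= !mul0r subr0 addr0 !eqxx.
Qed.

Lemma cplx_inj : injective (@cplx R).
Proof.
move=> u v [h0 h1]; apply/colP => i.
by case: (unliftP 0 i) => [j ->|-> //]; rewrite (ord1 j) (_ : lift _ _ = 1) //; exact/val_inj.
Qed.

Lemma enorm_cplx u : enorm u = normc (cplx u).
Proof. by []. Qed.

Lemma cplx_sum (I : Type) (r : seq I) (F : I -> 'cV[R]_2) :
  cplx (\sum_(i <- r) F i) = \sum_(i <- r) cplx (F i).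
Proof.
elim/big_ind2: _ => [|x1 x2 y1 y2 <- <-|//]; last by rewrite cplxD.
by rewrite /cplx !mxE.
Qed.

Lemma ord3_cases (P : 'I_3 -> Prop) : P 0 -> P 1 -> P 2 -> forall j, P j.
Proof.
move=> p0 p1 p2 [[|[|[|//]]] j3].
- by rewrite (_ : Ordinal j3 = 0) //; exact/val_inj.
- by rewrite (_ : Ordinal j3 = 1) //; exact/val_inj.
- by rewrite (_ : Ordinal j3 = 2) //; exact/val_inj.
Qed.

Lemma centroid_rot (y : triangle R) j :
  centroid y = 3^-1 *: (y j + y (j + 1) + y (j - 1)).
Proof.
have E (a b : 'I_3) : val a = val b -> y a = y b by move=> /val_inj ->.
rewrite /centroid; congr (_ *: _); elim/ord3_cases: j.
- by rewrite (E (0 + 1) 1 erefl) (E (0 - 1) 2 erefl).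
- by rewrite (E (1 + 1) 2 erefl) (E (1 - 1) 0 erefl) -addrA addrC.
- by rewrite (E (2 + 1) 0 erefl) (E (2 - 1) 1 erefl) addrC addrA.
Qed.

Lemma cplx_theta (y : triangle R) j :
  cplx (theta y j) =
  vertex_map (cplx (y j)) (cplx (y (j + 1))) (cplx (y (j - 1))).
Proof.
have jj : (j + 1) - 1 = j by rewrite addrK.
have jk : (j - 1) - 1 = j + 1 by elim/ord3_cases: j {jj}; exact/val_inj.
have cE : cplx (centroid y) =
    3^-1 * (cplx (y j) + cplx (y (j + 1)) + cplx (y (j - 1))).
  by rewrite (centroid_rot y j) cplxZ !cplxD fmorphV rmorph_nat.
rewrite /theta /vertex_map /vertex_ratio jj jk -cE.
rewrite !enorm_cplx !(cplxD, cplxN, cplxZ) //.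
Qed.

Definition hex_triples : seq (3.-tuple 'I_7) :=
  [:: [tuple 0; 1; 2]; [tuple 0; 2; 3]; [tuple 0; 3; 4];
      [tuple 0; 4; 5]; [tuple 0; 5; 6]; [tuple 0; 6; 1]].

Lemma mem_hexC t : (t \in hexC) = (t \in hex_triples).
Proof. by rewrite !inE -!orbA. Qed.

Lemma uniq_hex_triples : uniq hex_triples.
Proof. by vm_compute. Qed.

Lemma sum_triples_at (V : nmodType) (k : 'I_7) (F : 3.-tuple 'I_7 -> V) :
  \sum_(t in triples_at hexC k) F t = \sum_(t <- hex_triples | k \in t) F t.
Proof.
rewrite -[RHS]big_filter big_uniq ?filter_uniq ?uniq_hex_triples //.
by apply: eq_bigl => t; rewrite mem_filter [LHS]inE mem_hexC andbC.
Qed.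

Lemma card_triples_at (k : 'I_7) :
  #|triples_at hexC k| = count (fun t : 3.-tuple 'I_7 => k \in t) hex_triples.
Proof.
by rewrite -sum1_card sum_triples_at -sum1_count.
Qed.

Lemma cplx_Theta x (k : 'I_7) : cplx (col k (Theta hexC x)) =
  (count (fun t : 3.-tuple 'I_7 => k \in t) hex_triples)%:R^-1 *
  \sum_(t <- hex_triples | k \in t)
     let j := position k t in
     vertex_map (cplx (col (tnth t j) x)) (cplx (col (tnth t (j + 1)) x))
                (cplx (col (tnth t (j - 1)) x)).
Proof.
rewrite -card_triples_at.
have -> : col k (Theta hexC x) = #|triples_at hexC k|%:R^-1 *:
    \sum_(t in triples_at hexC k) theta (mesh_triangle x t) (position k t).
  by apply/colP => i; rewrite !mxE.
rewrite cplxZ sum_triples_at -big_filter cplx_sum big_filter fmorphV rmorph_nat.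
by congr (_ * _); apply: eq_bigr => t _; rewrite cplx_theta.
Qed.

(** Own, next and previous vertex in each triple at [k], as plain numbers so that the incidences can
    be computed; [m + 2] modulo 3 is the predecessor. *)
Definition hex_links (k : 'I_7) : seq (nat * nat * nat) :=
  [seq let m := index k t in
       (nat_of_ord (nth k t m), nat_of_ord (nth k t ((m + 1) %% 3)%N),
        nat_of_ord (nth k t ((m + 2) %% 3)%N))
  | t : 3.-tuple 'I_7 <- hex_triples & k \in t].

Lemma mesh_point_Theta_links x (k : 'I_7) :
  mesh_point (Theta hexC x) k = (size (hex_links k))%:R^-1 *
    \sum_(p <- hex_links k) vertex_map (mesh_point x p.1.1)
      (mesh_point x p.1.2) (mesh_point x p.2).
Proof.
rewrite /mesh_point inord_val cplx_Theta size_map size_filter big_map big_filter.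
congr (_ * _); apply: eq_bigr => t kt; cbv zeta; rewrite !inord_val.
have jE : nat_of_ord (position k t) = index k t.
  by rewrite inordK // -[3%N in leqRHS](size_tuple t) index_mem.
by rewrite !(tnth_nth k) /= jE.
Qed.

(** Only up to order: at rim vertices other than 1, the triple shared with the predecessor is listed
    first. *)
Lemma hex_linksE (k : 'I_7) : perm_eq (hex_links k)
  (if val k is 0 then [seq (0, s, rim_next s) | s <- index_iota 1 7]%N
   else [:: (val k, rim_next k, 0); (val k, 0, rim_prev k)]%N).
Proof.
by case: k => [[|[|[|[|[|[|[|//]]]]]]] k7]; vm_compute.
Qed.

Lemma mesh_point_Theta x k : (k < 7)%N ->
  mesh_point (Theta hexC x) k = hex_average (@vertex_map R) (mesh_point x) k.
Proof.
move=> k7; rewrite (mesh_point_Theta_links x (Ordinal k7)).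
have links := hex_linksE (Ordinal k7).
rewrite (perm_size links) (perm_big _ links) {links}.
rewrite [val _]/= /hex_average; case: k k7 => [|k] k7.
  by rewrite big_map size_map.
by rewrite !big_cons big_nil; congr (_ * (_ + _)); exact: addr0.
Qed.

End MeshTransformation.

(** * Similarities *)

Section Lipschitz.
Variable R : realType.

Lemma continuous_of_lipschitz (V W : normedModType R) (f : V -> W) (K : R) :
  (forall x y, `|f x - f y| <= K * `|x - y|) -> continuous f.
Proof.
move=> fK x; apply/cvgrPdist_lt => e e0.
have K1 : 0 < `|K| + 1 by rewrite ltr_wpDl.
have eK : 0 < e / (`|K| + 1) by rewrite divr_gt0.
near=> y.
have : `|x - y| < e / (`|K| + 1).
  by near: y; exact: cvgr_dist_lt.
rewrite ltr_pdivlMr // => h; apply: le_lt_trans h.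
apply: (le_trans (fK _ _)); rewrite mulrC ler_wpM2l //.
by have := ler_norm K; lra.
Unshelve. all: by end_near. Qed.

Lemma normr_coord_le m n (x : 'M[R]_(m, n)) i j : `|x i j| <= `|x|.
Proof.
rewrite [leRHS]/Num.norm /= mx_normrE.
exact: (le_bigmax _ (fun ij => `|x ij.1 ij.2|) (i, j)).
Qed.

Lemma normr_mx_le m n (x : 'M[R]_(m, n)) (M : R) : 0 <= M ->
  (forall i j, `|x i j| <= M) -> `|x| <= M.
Proof.
by move=> M0 h; rewrite [leLHS]/Num.norm /= mx_normrE; apply: bigmax_le.
Qed.

Lemma normc_cplx_le (v : 'cV[R]_2) : normc (cplx v) <= 2 * `|v|.
Proof.
apply: le_trans (normc_le_ReIm _) _ => /=.
by have := normr_coord_le v 0 0; have := normr_coord_le v 1 0; lra.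
Qed.

Lemma normr_le_cplx (v : 'cV[R]_2) : `|v| <= normc (cplx v).
Proof.
apply: normr_mx_le => [|i j]; first exact: normc_ge0.
rewrite (ord1 j); case: (unliftP 0 i) => [k ->|->].
  by rewrite (ord1 k) (_ : lift _ _ = 1); [exact: (normr_Im_le (cplx v))|exact/val_inj].
exact: (normr_Re_le (cplx v)).
Qed.

End Lipschitz.

(** * Similarities as complex affine maps *)

Section Similarities.
Variable R : realType.
Implicit Types (g : 'cV[R]_2 -> 'cV[R]_2) (e t : R[i]) (v : 'cV[R]_2).

Lemma mulmx2E (A : 'M[R]_2) v i : (A *m v) i 0 = A i 0 * v 0 0 + A i 1 * v 1 0.
Proof.
rewrite mxE !big_ord_recl big_ord0 addr0.
by rewrite (_ : lift _ _ = 1 :> 'I_2) //; exact/val_inj.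
Qed.

Lemma det_mx2 (A : 'M[R]_2) : \det A = A 0 0 * A 1 1 - A 0 1 * A 1 0.
Proof.
rewrite (expand_det_row _ 0) !big_ord_recl big_ord0 addr0 /cofactor !det_mx11.
rewrite !mxE /= expr0 mul1r expr1 mulN1r mulrN.
by congr (A _ _ * A _ _ - A _ _ * A _ _); exact/val_inj.
Qed.

Lemma Sim_cplx g : Sim g ->
  exists e t, e != 0 /\ forall v, cplx (g v) = e * cplx v + t.
Proof.
move=> [l [A [b [l0 [AA dA] gE]]]].
have AE i j : A i 0 * A j 0 + A i 1 * A j 1 = (i == j)%:R.
  have := congr1 (fun M : 'M[R]_2 => M i j) AA; rewrite !mxE.
  rewrite !big_ord_recl big_ord0 addr0 !mxE.
  by rewrite (_ : lift _ _ = 1 :> 'I_2) //; exact/val_inj.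
have h00 := AE 0 0; have h11 := AE 1 1.
move: dA; rewrite det_mx2 => dA; rewrite /= in h00 h11.
(* The two rows have norm 1 and the determinant is 1, so this sum is 1 + 1 - 2; hence [A] is
   multiplication by a complex number. *)
have s0 : (A 0 0 - A 1 1) ^+ 2 + (A 0 1 + A 1 0) ^+ 2 = 0.
  by rewrite !expr2; lra.
have /eqP := s0; rewrite paddr_eq0 ?sqr_ge0 // !sqrf_eq0 subr_eq0 addr_eq0.
move=> /andP[/eqP e1 /eqP e2].
exists (l%:C%C * Complex (A 0 0) (A 1 0)), (l%:C%C * cplx b); split.
  apply: mulf_neq0; first by rewrite fmorph_eq0 gt_eqF.
  rewrite eq_complex /=.
  apply/negP => /andP[/eqP a0 /eqP a1].
  move: dA; rewrite a0 a1 mul0r mulr0 subr0 => /esym/eqP.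
  by rewrite oner_eq0.
move=> v; rewrite gE cplxZ cplxD mulrDr -mulrA; congr (_ * _ + _).
rewrite /cplx !mulmx2E e2 -e1.
by apply/eqP; rewrite eq_complex /=; apply/andP; split; apply/eqP; ring.
Qed.

Lemma cplx_Sim e t : e != 0 ->
  exists2 g, Sim g & forall v, cplx (g v) = e * cplx v + t.
Proof.
move=> e0; pose l := normc e.
have l0 : 0 < l.
  rewrite lt_def normc_ge0 andbT; apply: contra_neq e0; exact: eq0_normc.
have ln0 : l != 0 by rewrite gt_eqF.
(* The rotation is [e / l]; [t] is divided by [l] because the scaling also acts on the translation
   part. *)
pose A : 'M[R]_2 := l^-1 *: \matrix_(i, j)
  (if i == j then complex.Re e else if i == 0 then - complex.Im e else complex.Im e).
pose b : 'cV[R]_2 := l^-1 *: \col_i (if i == 0 then complex.Re t else complex.Im t).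
have le : l ^+ 2 = complex.Re e ^+ 2 + complex.Im e ^+ 2.
  exact: normc_def_sqr.
exists (fun v => l *: (A *m v + b)).
  exists l, A, b; split => //; split.
    apply/matrixP => i j; rewrite !mxE !big_ord_recl big_ord0 addr0 !mxE.
    rewrite (_ : lift _ _ = 1 :> 'I_2); last exact/val_inj.
    by case: (unliftP 0 i) => [k ->|->]; case: (unliftP 0 j) => [k' ->|->];
      rewrite ?(ord1 k) ?(ord1 k') /=; field: le.
  by rewrite det_mx2 !mxE /=; field: le.
move=> v; rewrite cplxZ cplxD /cplx !mulmx2E !mxE /=.
by case: (e) (t) => [e1 e2] [t1 t2]; apply/eqP; rewrite eq_complex /=;
  apply/andP; split; apply/eqP; field.
Qed.

End Similarities.

(** * Regular hexagons and their orbit *)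

Section Hexagons.
Variable R : realType.
Local Notation z := (zeta R).
Implicit Types (x y : 'M[R]_(2, 7)) (a e b : R[i]).

(** For edge vectors [u], [v] from vertex 0 and [q = |u|^2], equal sides give [|v|^2 = q] and inner
    product [q / 2]. Lagrange's identity yields the area up to sign, orientation fixes the sign, and
    then [|v - zeta u|^2] expands to 0. *)
Lemma equilateral_turn (y : triangle R) :
  equilateral y -> 0 < signed_area2 y ->
  cplx (y 2) - cplx (y 0) = z * (cplx (y 1) - cplx (y 0)).
Proof.
move=> [E1 E2].
have sqE (p q : 'cV[R]_2) : enorm (p - q) ^+ 2 =
    (p 0 0 - q 0 0) ^+ 2 + (p 1 0 - q 1 0) ^+ 2.
  by rewrite sqr_sqrtr ?addr_ge0 ?sqr_ge0 // !mxE.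
have := congr1 (fun r => r ^+ 2) E1; have := congr1 (fun r => r ^+ 2) E2.
rewrite !sqE /signed_area2 /cplx !mxE /zeta.
have : (Num.sqrt 3 / 2) ^+ 2 = 3 / 4 :> R.
  by rewrite exprMn sqr_sqrtr //; field.
have : 0 < Num.sqrt 3 / 2 :> R by rewrite divr_gt0 // sqrtr_gt0.
move: (Num.sqrt 3 / 2) (y 0 0 0) (y 0 1 0) (y 1 0 0) (y 1 1 0) (y 2 0 0) (y 2 1 0).
move=> k a0 b0 a1 b1 a2 b2 k0 kk.
pose u0 := a1 - a0; pose u1 := b1 - b0; pose v0 := a2 - a0; pose v1 := b2 - b0.
rewrite -/u0 -/u1 -/v0 -/v1 => F2 F1 P0.
have vu : v0 ^+ 2 + v1 ^+ 2 = u0 ^+ 2 + u1 ^+ 2.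
  by rewrite /u0 /u1 -F2 -F1 /v0 /v1; ring.
have uB : u0 ^+ 2 + u1 ^+ 2 = (u0 - v0) ^+ 2 + (u1 - v1) ^+ 2.
  transitivity ((a0 - a1) ^+ 2 + (b0 - b1) ^+ 2); first by rewrite /u0 /u1; ring.
  by rewrite F1 /u0 /u1 /v0 /v1; ring.
have uv : u0 * v0 + u1 * v1 = (u0 ^+ 2 + u1 ^+ 2) / 2.
  move: uB vu; clearbody u0 u1 v0 v1; rewrite !expr2; lra.
set q := u0 ^+ 2 + u1 ^+ 2 in vu uv.
set P := _ - _ in P0.
have q0 : 0 <= q by rewrite addr_ge0 ?sqr_ge0.
have PP : P ^+ 2 = 3 / 4 * q ^+ 2.
  have -> : P ^+ 2 = (u0 ^+ 2 + u1 ^+ 2) * (v0 ^+ 2 + v1 ^+ 2)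
      - (u0 * v0 + u1 * v1) ^+ 2 by rewrite /P; ring.
  by rewrite vu uv -/q; field.
have Pk : P = k * q.
  have : (P - k * q) * (P + k * q) = 0.
    by rewrite -subr_sqr exprMn kk PP subrr.
  move/eqP; rewrite mulf_eq0 subr_eq0 => /orP[/eqP //|].
  by rewrite gt_eqF // ltr_wpDr // mulr_ge0 // ltW.
have : (v0 - (u0 / 2 - k * u1)) ^+ 2 + (v1 - (k * u0 + u1 / 2)) ^+ 2 = 0.
  have -> : (v0 - (u0 / 2 - k * u1)) ^+ 2 + (v1 - (k * u0 + u1 / 2)) ^+ 2 =
     (v0 ^+ 2 + v1 ^+ 2) + (1 / 4 + k ^+ 2) * q - (u0 * v0 + u1 * v1) - 2 * k * P.
    by rewrite /q /P; field.
  rewrite vu uv Pk kk (_ : 2 * k * (k * q) = 2 * k ^+ 2 * q); last by ring.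
  by rewrite kk; field.
move/eqP; rewrite paddr_eq0 ?sqr_ge0 // !sqrf_eq0 !subr_eq0.
move=> /andP[/eqP e0 /eqP e1].
apply/eqP; rewrite eq_complex /= -/u0 -/u1 -/v0 -/v1 e0 e1.
by apply/andP; split; apply/eqP; field.
Qed.

Lemma equilateral_mesh_points x : is_mesh hexC x ->
    (forall t, t \in hexC -> equilateral (mesh_triangle x t)) ->
  exists2 a, a != 0 &
    forall s, (s < 6)%N -> mesh_point x s.+1 = mesh_point x 0 + a * z ^+ s.
Proof.
move=> [_ inj pos _] eql.
exists (mesh_point x 1 - mesh_point x 0).
  rewrite subr_eq0; apply/eqP => /cplx_inj /inj /(congr1 val).
  by rewrite /= !inordK.
have turn s : (s < 5)%N -> mesh_point x s.+2 - mesh_point x 0 =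
    z * (mesh_point x s.+1 - mesh_point x 0).
  move=> s5; pose t := nth [tuple 0; 1; 2] hex_triples s.
  have tC : t \in hexC.
    by rewrite mem_hexC mem_nth // (leq_trans s5).
  have tE : [/\ tnth t 0 = inord 0, tnth t 1 = inord s.+1 & tnth t 2 = inord s.+2].
    rewrite /t; move: s s5 {t tC} => [|[|[|[|[|//]]]]] _ /=;
    by split; apply/val_inj; rewrite /= inordK.
  have := equilateral_turn (eql _ tC) (pos _ tC).
  by rewrite /mesh_triangle; case: tE => -> -> ->.
elim=> [|s IH] s6; first by rewrite expr0 mulr1 addrC subrK.
rewrite -[LHS](subrK (mesh_point x 0)) turn // IH ?(ltnW s6) //.
by rewrite addrC; congr (_ + _); rewrite addrAC subrr add0r exprS mulrCA.
Qed.

Lemma mesh_point_act x g e (t : R[i]) k : (forall v, cplx (g v) = e * cplx v + t) ->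
  mesh_point (mesh_act g x) k = e * mesh_point x k + t.
Proof.
move=> gE; rewrite /mesh_point -gE; congr (cplx _).
by apply/colP => i; rewrite !mxE.
Qed.

Lemma mesh_point_inj x y :
  (forall k, (k < 7)%N -> mesh_point x k = mesh_point y k) -> x = y.
Proof.
move=> h; apply/matrixP => i k.
have /cplx_inj/colP/(_ i) := h k (ltn_ord k).
by rewrite !mxE inord_val.
Qed.

Lemma Sim_orbit_hexagon x y a : Sim_orbit x y -> a != 0 ->
    (forall s, (s < 6)%N -> mesh_point x s.+1 = mesh_point x 0 + a * z ^+ s) ->
  exists2 b, b != 0 &
    forall s, (s < 6)%N -> mesh_point y s.+1 = mesh_point y 0 + b * z ^+ s.
Proof.
move=> [g /Sim_cplx[e [t [e0 gE]]] <-] a0 xE.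
exists (e * a) => [|s s6]; first exact: mulf_neq0.
by rewrite !(mesh_point_act _ _ gE) xE //; ring.
Qed.

(** The similarity multiplies by [b / a] and takes center to center. *)
Lemma hexagon_Sim_orbit x y a b : a != 0 -> b != 0 ->
    (forall s, (s < 6)%N -> mesh_point x s.+1 = mesh_point x 0 + a * z ^+ s) ->
    (forall s, (s < 6)%N -> mesh_point y s.+1 = mesh_point y 0 + b * z ^+ s) ->
  Sim_orbit x y.
Proof.
move=> a0 b0 xE yE.
have [g gS gE] := @cplx_Sim R (b / a) (mesh_point y 0 - b / a * mesh_point x 0)
  (mulf_neq0 b0 (invr_neq0 a0)).
exists g => //; apply: mesh_point_inj => k k7; rewrite (mesh_point_act _ _ gE).
case: k k7 => [|s] s7; first by ring.
by rewrite xE // yE //; field.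
Qed.

(** Ensures that the limit is a mesh. A similarity is an affine homeomorphism, so common interior
    points pull back, and it multiplies signed areas by the squared modulus of [e]. *)
Lemma is_mesh_act x g : Sim g -> is_mesh hexC x -> is_mesh hexC (mesh_act g x).
Proof.
move=> /Sim_cplx[e [t [e0 gE]]] [conn inj pos disj].
have colE k : col k (mesh_act g x) = g (col k x).
  by apply/colP => i; rewrite !mxE.
have g_inj : injective g.
  move=> u v /(congr1 (@cplx R)); rewrite !gE => /addIr /(mulfI e0).
  exact: cplx_inj.
have g_cont : continuous g.
  apply: (@continuous_of_lipschitz _ _ _ g (normc e * 2)) => u v.
  apply: le_trans (normr_le_cplx _) _.
  rewrite cplxB !gE opprD addrACA subrr addr0 -mulrBr -cplxB normcM -mulrA.
  by rewrite ler_wpM2l ?normc_ge0 // normc_cplx_le.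
have g_surj v : exists u, g u = v.
  have [h _ hE] := @cplx_Sim R e^-1 (- (e^-1 * t)) (invr_neq0 e0).
  by exists (h v); apply: cplx_inj; rewrite gE hE; field.
have g_affine s (p : 'cV[R]_2) : triangle_set (mesh_triangle (mesh_act g x) s) (g p) ->
    triangle_set (mesh_triangle x s) p.
  move=> [c [c0 c1 pE]]; exists c; split => //; apply: g_inj; rewrite pE.
  apply: cplx_inj; rewrite gE !cplx_sum mulr_sumr.
  have -> : t = \sum_j (c j)%:C%C * t.
    by rewrite -mulr_suml -rmorph_sum c1 rmorph1 mul1r.
  rewrite -big_split; apply: eq_bigr => j _.
  by rewrite /mesh_triangle colE !cplxZ gE /=; ring.
have int_g s q : (triangle_set (mesh_triangle (mesh_act g x) s))° (g q) ->
    (triangle_set (mesh_triangle x s))° q.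
  move=> h; have hq : nbhs q (g @^-1` triangle_set (mesh_triangle (mesh_act g x) s)).
    exact: (g_cont q _ h).
  exact: (@filterS _ (nbhs q) _ _ _ (@g_affine s) hq).
split => //.
- by move=> k l /=; rewrite !colE => /g_inj; exact: inj.
- move=> s sC; have p := pos s sC.
  have gB u v : cplx (g u - g v) = e * cplx (u - v).
    by rewrite !cplxB !gE; ring.
  rewrite /signed_area2 /mesh_triangle !colE in p *.
  move: (gB (col (tnth s 1) x) (col (tnth s 0) x)) (gB (col (tnth s 2) x) (col (tnth s 0) x)) p.
  rewrite /cplx.
  set u := g _ - g _; set v := g _ - g _.
  set u' := col _ _ - col _ _; set v' := col _ _ - col _ _.
  have ee : 0 < complex.Re e ^+ 2 + complex.Im e ^+ 2.
    rewrite -normc_def_sqr exprn_gt0 // lt_def normc_ge0 andbT.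
    by apply: contra_neq e0; exact: eq0_normc.
  move: ee; case: (e) => e1 e2 /= ee [-> ->] [-> ->] p.
  rewrite (_ : _ - _ = (e1 ^+ 2 + e2 ^+ 2) * (u' 0 0 * v' 1 0 - u' 1 0 * v' 0 0)).
    exact: mulr_gt0.
  by ring.
- move=> s r sC rC sr; rewrite -subset0 => q [].
  have [p <-] := g_surj q; move=> /int_g ps /int_g pr.
  by have := disj s r sC rC sr; rewrite -subset0 => /(_ p); apply.
Qed.

End Hexagons.

(** * Convergence near a regular hexagon *)

Section LocalDynamics.
Variable R : realType.
Local Notation N := (@normc R).
Local Notation z := (zeta R).
Implicit Types (x y : 'M[R]_(2, 7)) (w : nat -> R[i]) (b : R[i]).

Lemma transverse_norm_ext w w' : (forall k, (k < 7)%N -> w k = w' k) ->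
  transverse_norm w = transverse_norm w'.
Proof.
move=> ww; apply: eq_bigr => i _; congr (N (_ - _)); last by case: i => //; rewrite ww.
by rewrite big_nat [RHS]big_nat; apply: eq_bigr => s /andP[_ s6]; rewrite ww.
Qed.

Lemma mesh_pointB x y k : mesh_point (x - y) k = mesh_point x k - mesh_point y k.
Proof. by rewrite /mesh_point -cplxB; congr cplx; apply/colP => i; rewrite !mxE. Qed.

Lemma normc_mesh_point x k : N (mesh_point x k) <= 2 * `|x|.
Proof.
apply: le_trans (normc_cplx_le _) _; rewrite ler_pM2l //.
by apply: normr_mx_le => // i j; rewrite mxE; exact: normr_coord_le.
Qed.

Lemma normr_le_mesh_point x (M : R) :
  (forall k, (k < 7)%N -> N (mesh_point x k) <= M) -> `|x| <= M.
Proof.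
move=> xM; apply: normr_mx_le => [|i k].
  exact: le_trans (normc_ge0 _) (xM 0%N isT).
have -> : x i k = col k x i 0 by rewrite mxE.
apply: le_trans (normr_coord_le _ _ _) _; apply: le_trans (normr_le_cplx _) _.
by have := xM k (ltn_ord k); rewrite /mesh_point inord_val.
Qed.

(** The constant is 36 from [transverse_norm_le] times 2 for passing from the sup norm to the
    modulus. *)
Lemma transverse_norm_lipschitz x y :
  transverse_norm (mesh_point x) - transverse_norm (mesh_point y) <= 72 * `|x - y|.
Proof.
rewrite lerBlDl; apply: le_trans (transverse_normD _ (mesh_point y)) _.
rewrite lerD2l (_ : 72 * _ = 36 * (2 * `|x - y|)); last by ring.
by apply: transverse_norm_le => k _; rewrite -mesh_pointB; exact: normc_mesh_point.
Qed.

Lemma continuous_transverse_norm :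
  continuous (fun x => transverse_norm (mesh_point x)).
Proof.
apply: (@continuous_of_lipschitz _ _ _ _ 72) => x y; rewrite ler_norml.
have := transverse_norm_lipschitz x y; have := transverse_norm_lipschitz y x.
by rewrite (distrC y x); lra.
Qed.

(** The spread has modulus [N b * N (1 + z) / 3], and the real part of [1 + z] is 3/2. *)
Lemma normc_spread_hexagon w b s : (0 < s < 7)%N ->
    (forall s, (s < 6)%N -> w s.+1 = w 0%N + b * z ^+ s) ->
  N b / 2 <= N (spread (w 0%N) (w s) (w (rim_next s))).
Proof.
case: s => // s s6 wE.
have -> : spread (w 0%N) (w s.+1) (w (rim_next s.+1)) =
    - (b * z ^+ s * (3^-1 * (1 + z))).
  rewrite /spread; case: s s6 => [|[|[|[|[|[|//]]]]]] _;
  by rewrite !wE //; field: (zeta_sq R).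
rewrite normc_opp !normcM normcV normc_nat normc_zetaX mulr1.
rewrite ler_wpM2l ?normc_ge0 //.
have := le_trans (ler_norm _) (normr_Re_le (1 + z)); rewrite [complex.Re _]/=; lra.
Qed.

Lemma spread_perturb x y s : N (spread (mesh_point x 0) (mesh_point x s)
     (mesh_point x (rim_next s))) <=
  N (spread (mesh_point y 0) (mesh_point y s) (mesh_point y (rim_next s)))
  + 2 * `|x - y|.
Proof.
rewrite (_ : spread (mesh_point x 0) _ _ =
    spread (mesh_point y 0) (mesh_point y s) (mesh_point y (rim_next s)) +
    spread (mesh_point (x - y) 0) (mesh_point (x - y) s)
      (mesh_point (x - y) (rim_next s))); last first.
  by rewrite !mesh_pointB /spread; ring.
apply: le_trans (normc_triangle _ _) _; rewrite lerD2l.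
rewrite /spread normcM normcV normc_nat ler_pdivrMl //.
apply: le_trans (normc_triangle _ _) _.
apply: le_trans (lerD (normc_triangle _ _) (lexx _)) _.
rewrite normc_opp !normcM zetaB1 normc_zetaX normc_zeta !mul1r.
have := normc_mesh_point (x - y) 0; have := normc_mesh_point (x - y) s.
have := normc_mesh_point (x - y) (rim_next s); lra.
Qed.

Lemma transverse_norm_hexagon y b :
    (forall s, (s < 6)%N -> mesh_point y s.+1 = mesh_point y 0 + b * z ^+ s) ->
  transverse_norm (mesh_point y) = 0.
Proof.
move=> yE; rewrite /transverse_norm big_nat big1 // => i /andP[_ i5].
rewrite (_ : transverse_mode i _ = 0) ?normc0 // /transverse_mode.
by case: i i5 => [|[|[|[|[|//]]]]] _; rewrite unlock /= !yE //; ring: (zeta_sq R).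
Qed.

Lemma Theta_near_hexagon y b : b != 0 ->
    (forall s, (s < 6)%N -> mesh_point y s.+1 = mesh_point y 0 + b * z ^+ s) ->
  \forall x \near y, exists x',
    [/\ exists2 b', b' != 0 & forall s, (s < 6)%N ->
          mesh_point x' s.+1 = mesh_point x' 0 + b' * z ^+ s
      & (fun n => iter n (Theta hexC) x) @ \oo --> x'].
Proof.
move=> b0 yE.
have nb : 0 < N b.
  by rewrite lt_def normc_ge0 andbT; apply: contra_neq b0; exact: eq0_normc.
have dy := transverse_norm_hexagon yE.
(* With [h = N b / 4], [72 * r] is the threshold [h / 108] of [hex_average_step]. Spreads of the
   hexagon are at least [N b / 2], and moving by [r] costs at most [2 * r], which leaves [h]. *)
have [r rE] : exists r, r = N b / 432 / 72 by exists (N b / 432 / 72).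
have near_spread x : `|x - y| < r -> forall s, (0 < s < 7)%N ->
    N b / 4 <= N (spread (mesh_point x 0) (mesh_point x s) (mesh_point x (rim_next s))).
  move=> xr s s7; have := spread_perturb y x s.
  have := normc_spread_hexagon s7 yE; rewrite distrC; rewrite rE in xr; lra.
have step x : `|x - y| < r ->
    transverse_norm (mesh_point (Theta hexC x))
      <= 17 / 18 * transverse_norm (mesh_point x) /\
    `|Theta hexC x - x| <= transverse_norm (mesh_point x).
  move=> xr; have [|||S1 S2] := @hex_average_step R (N b / 4) (mesh_point x).
  - by rewrite divr_gt0.
  - exact: near_spread.
  - have := transverse_norm_lipschitz x y; rewrite dy; rewrite rE in xr; lra.
  split; first by rewrite (transverse_norm_ext (@mesh_point_Theta R x)).
  apply: normr_le_mesh_point => k k7.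
  by rewrite mesh_pointB mesh_point_Theta //; exact: S2.
have r0 : 0 < r by rewrite rE !divr_gt0.
have q01 : 0 <= (17 / 18 : R) < 1 by apply/andP; split; lra.
apply: filterS (iter_cvg_of_contracting_defect r0 q01
  (fun x => transverse_norm_ge0 (mesh_point x)) continuous_transverse_norm dy
  (fun x xr => (step x xr).1) (fun x xr => (step x xr).2)).
move=> x [x' [x'y dx' cv]]; exists x'; split=> //.
have [b' x'E] := transverse_norm_eq0 dx'; exists b' => //.
(* The limit still lies in the ball, where spreads are bounded below; a hexagon collapsed to a point
   has spread 0. *)
apply/eqP => b'0; have := near_spread x' x'y 1%N isT.
rewrite /spread !x'E // b'0 !mul0r !addr0.
rewrite (_ : _ - z * _ + _ = 0); last by ring.
by rewrite mulr0 normc0; lra.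
Qed.


End LocalDynamics.

Theorem mainTheorem3 (R : realType) (x_eq : 'M[R]_(2, 7))
    (x_eq_mesh : is_mesh hexC x_eq)
    (x_eq_equilateral : forall t : 3.-tuple 'I_7,
       t \in hexC -> equilateral (mesh_triangle x_eq t)) :
  exists U : set 'M[R]_(2, 7),
    set_nbhs (Sim_orbit x_eq) U /\
    forall x : 'M[R]_(2, 7), U x -> is_mesh hexC x ->
      exists y : 'M[R]_(2, 7),
        [/\ is_mesh hexC y, Sim_orbit x_eq y
          & (fun n => iter n (Theta hexC) x) @ \oo --> y].
Proof.
have [a a0 x_eqE] := equilateral_mesh_points x_eq_mesh x_eq_equilateral.
(* The neighborhood is the whole basin of attraction; around each orbit point it contains the
   neighborhood given by [Theta_near_hexagon]. *)
exists [set x | exists y, [/\ is_mesh hexC y, Sim_orbit x_eq y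
          & (fun n => iter n (Theta hexC) x) @ \oo --> y]].
split=> [y x_eq_y|x [y yP] _]; last by exists y.
have [b b0 yE] := Sim_orbit_hexagon x_eq_y a0 x_eqE.
apply: filterS (Theta_near_hexagon b0 yE) => x [x' [[b' b'0 x'E] cv]].
have x'_orbit : Sim_orbit x_eq x' by exact: hexagon_Sim_orbit a0 b'0 x_eqE x'E.
exists x'; split=> //.
by have [g gS <-] := x'_orbit; exact: is_mesh_act.
Qed.
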